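(* Let $B$ be a commutative monoid, written additively with neutral element $0$, and let $s(B)$ be its symmetrization, endowed with its hypersum $+$, and $i:B\to s(B)$, $b\mapsto (b,1)$. (i) $s(B)$ is a hypergroup if and only if $B$ fulfills the following property: for all $x,y,u,v\in B$ with $x+y=u+v$, there exists $z\in B$ such that either ($x+z=u$ and $z+v=y$) or ($x=u+z$ and $v=z+y$). (ii) If $B$ fulfills this property, then the pair $(s(B),i)$ is universal: $i$ is an additive map to the hypergroup $s(B)$, and for every hypergroup $K$ and every additive map $g:B\to K$ there exists a unique morphism of hypergroups $h:s(B)\to K$ such that $g=h\circ i$.
   Context: Hypergroup (meaning canonical hypergroup): a set $H$ with an element $0\in H$ and a map $+:H\times H\to \mathcal P(H)^*$, where $\mathcal P(H)^*$ is the set of non-empty subsets of $H$, such that, with $A+A':=\bigcup_{a\in A,a'\in A'}(a+a')$ for subsets $A,A'\subseteq H$ and elements identified with singletons: (1) $x+y=y+x$; (2) $(x+y)+z=x+(y+z)$; (3) $0+x=x=x+0$; (4) for every $x\in H$ there is a unique $y\in H$, denoted $-x$, with $0\in x+y$; (5) $x\in y+z$ implies $z\in x-y:=x+(-y)$. A morphism of hypergroups $h:H\to K$ is a map with $h(0)=0$ and $h(x+y)\subseteq h(x)+h(y)$ for all $x,y\in H$. For a commutative monoid $B$ and a hypergroup $K$, a map $g:B\to K$ is additive if $g(0)=0$ and $g(a+b)\in g(a)+g(b)$ for all $a,b\in B$. Symmetrization: $s(B)$ is the quotient of $B\times\{-1,1\}$ by the equivalence relation which identifies $(a,1)\sim(b,-1)$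 whenever $a+b=0$ in $B$ (classes are written by representatives). Its hypersum is the commutative operation, with values in subsets of $s(B)$, given by $(a,1)+(b,1)=\{(a+b,1)\}$, $(a,-1)+(b,-1)=\{(a+b,-1)\}$, $(a,1)+(b,-1)=\{(z,1): z\in B,\ z+b=a\}\cup\{(z,-1): z\in B,\ z+a=b\}$; this is compatible with the equivalence relation. Its neutral element is the class $(0,1)=(0,-1)$. The hypersum may a priori take the empty set as a value; saying that $s(B)$ is a hypergroup means that all its values are non-empty and that axioms (1)-(5) hold. *)

(* Defs.v *)
From HB Require Import structures.
From mathcomp Require Import all_boot all_algebra.
From mathcomp Require Import classical_sets.

Set Implicit Arguments.
Unset Strict Implicit.
Unset Printing Implicit Defensive.

Import GRing.Theory.

Local Open Scope ring_scope.
Local Open Scope classical_set_scope.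
Local Open Scope quotient_scope.

Record hypermagma := Hypermagma {
  hsort :> Type;
  hzero : hsort;
  hadd : hsort -> hsort -> set hsort }.

Arguments hzero {h}.
Arguments hadd {h} x y.

Definition hadd_set (H : hypermagma) (A A' : set H) : set H :=
  \bigcup_(a in A) \bigcup_(a' in A') hadd a a'.

(* In [hg_rev], [y'] is the element -y, which exists and is unique
   by [hg_opp]. *)
Record is_hypergroup (H : hypermagma) : Prop := IsHypergroup {
  hg_nonempty : forall x y : H, hadd x y !=set0;
  hg_comm : forall x y : H, hadd x y = hadd y x;
  hg_assoc : forall x y z : H,
    hadd_set (hadd x y) [set z] = hadd_set [set x] (hadd y z);
  hg_zero : forall x : H, hadd hzero x = [set x] /\ hadd x hzero = [set x];
  hg_opp : forall x : H, exists! y : H, hadd x y hzero;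
  hg_rev : forall x y z y' : H,
    hadd y y' hzero -> hadd y z x -> hadd x y' z }.

Definition is_hmorphism (H K : hypermagma) (h : H -> K) : Prop :=
  h hzero = hzero /\
  forall x y : H, h @` hadd x y `<=` hadd (h x) (h y).

Definition is_additive (B : nmodType) (K : hypermagma) (g : B -> K) : Prop :=
  g 0 = hzero /\ forall a b : B, hadd (g a) (g b) (g (a + b)).

(* Signs are booleans: [true] is 1 and [false] is -1. *)
Section Symmetrization.
Variable B : nmodType.

Definition sym_rel : rel (B * bool) := fun p q =>
  if p.2 == q.2 then p.1 == q.1 else p.1 + q.1 == 0.

Fact sym_rel_refl : reflexive sym_rel.
Proof. by move=> p; rewrite /sym_rel !eqxx. Qed.

Fact sym_rel_sym : symmetric sym_rel.
Proof.
by move=> p q; rewrite /sym_rel [q.2 == _]eq_sym [q.1 == _]eq_sym addrC.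
Qed.

Let opp_uniq (a b c : B) : a + b = 0 -> b + c = 0 -> a = c.
Proof. by move=> ab bc; rewrite -[a]addr0 -bc addrA ab add0r. Qed.

Fact sym_rel_trans : transitive sym_rel.
Proof.
move=> [b t] [a s] [c u]; rewrite /sym_rel /=.
case: s t u => [] [] [] /= /eqP e1 /eqP e2; apply/eqP;
  do ?[by rewrite e1 | by rewrite -e2 | exact: opp_uniq e1 e2].
Qed.

Canonical sym_equiv :=
  EquivRel sym_rel sym_rel_refl sym_rel_sym sym_rel_trans.

Definition sym_type := {eq_quot sym_equiv}.

Definition sym_class (p : B * bool) : sym_type := \pi p.

Definition sym_hadd_repr (p q : B * bool) : set sym_type :=
  match p, q with
  | (a, true), (b, true) => [set sym_class (a + b, true)]
  | (a, false), (b, false) => [set sym_class (a + b, false)]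
  | (a, true), (b, false) | (b, false), (a, true) =>
      [set sym_class (z, true) | z in [set z | z + b = a]] `|`
      [set sym_class (z, false) | z in [set z | z + a = b]]
  end.

Definition sym_hadd (x y : sym_type) : set sym_type :=
  sym_hadd_repr (repr x) (repr y).

Definition sym_hypermagma : hypermagma :=
  Hypermagma (sym_class (0, true)) sym_hadd.

Definition sym_inj (b : B) : sym_hypermagma := sym_class (b, true).

Lemma sym_classP (p q : B * bool) :
  reflect (sym_class p = sym_class q) (sym_rel p q).
Proof. exact: (@eqmodP _ sym_equiv). Qed.

Let sym_hadd_reprC p q : sym_hadd_repr p q = sym_hadd_repr q p.
Proof. by case: p q => a [] [b []]; rewrite //= addrC. Qed.

Let mixed_hadd (a b c : B) (s : bool) : a + b = 0 ->
  sym_hadd_repr (b, ~~ s) (c, s) = [set sym_class (a + c, s)].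
Proof.
move=> ab; have ba : b + a = 0 by rewrite addrC.
apply/seteqP; split=> w.
- case: s => /= -[[z zE <-]|[z zE <-]]; apply/sym_classP;
    rewrite /sym_rel /=.
  + by rewrite -zE addrCA ab addr0.
  + by rewrite addrCA zE ab.
  + by rewrite addrCA zE ab.
  + by rewrite -zE addrCA ab addr0.
- by case: s => /= ->; [left|right]; exists (a + c);
    rewrite //= addrAC ab add0r.
Qed.

Let sym_hadd_repr_compl p p' q :
  sym_rel p p' -> sym_hadd_repr p q = sym_hadd_repr p' q.
Proof.
case: p p' q => [a s] [b t] [c u]; rewrite /sym_rel /=.
case: eqP => [-> /eqP -> //|st /eqP ab].
have {st} tE : t = ~~ s by case: s t st => [] [].
have ba : b + a = 0 by rewrite addrC.
rewrite {}tE; have mE := fun s => @mixed_hadd _ _ c s ab; have mE' := fun s => @mixed_hadd _ _ c s ba.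
case: s u => [] []; move: (mE true) (mE false) (mE' true) (mE' false) => /= e1 e2 e3 e4 //.
Qed.

(* The hypersum of two classes may be computed on any representatives. *)
Lemma sym_haddE p q :
  sym_hadd (sym_class p) (sym_class q) = sym_hadd_repr p q.
Proof.
have reprE r : sym_rel (repr (sym_class r)) r.
  by apply/sym_classP; rewrite /sym_class reprK.
rewrite /sym_hadd (sym_hadd_repr_compl _ (reprE p)) sym_hadd_reprC.
by rewrite (sym_hadd_repr_compl _ (reprE q)) sym_hadd_reprC.
Qed.

Definition sym_property : Prop :=
  forall x y u v : B, x + y = u + v ->
  exists z : B, (x + z = u /\ z + v = y) \/ (x = u + z /\ v = z + y).

End Symmetrization.

(* Main.v *)
Require Import Defs.
From mathcomp Require Import all_boot all_algebra.
From mathcomp Require Import classical_sets.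
From mathcomp Require Import boolp.

(** Write a signed element p as a formal difference pos p - neg p.  Then r lies
    in p + q iff pos p + pos q + neg r = neg p + neg q + pos r, an equation in B
    from which commutativity, the inverses and reversibility can be read off.
    The property of B says exactly that an equation x + y = u + v can be cut
    in the middle by a signed element; hence w lies in (p + q) + r iff
    pos p + pos q + pos r + neg w = neg p + neg q + neg r + pos w, and this
    condition does not depend on the bracketing. *)

Set Implicit Arguments.
Unset Strict Implicit.
Unset Printing Implicit Defensive.

Import GRing.Theory.

Local Open Scope ring_scope.
Local Open Scope classical_set_scope.

Lemma hadd_setC (H : hypermagma) (A A' : set H) :
  (forall x y : H, hadd x y = hadd y x) -> hadd_set A A' = hadd_set A' A.
Proof.
move=> hC; apply/seteqP; split=> w [a aA [a' a'A waa']];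
  by exists a' => //; exists a => //; rewrite hC.
Qed.

Section Symmetrization.
Variable B : nmodType.
Implicit Types (a b c : B) (p q r w : B * bool).

Definition pos_part p : B := if p.2 then p.1 else 0.
Definition neg_part p : B := if p.2 then 0 else p.1.

Local Notation pos := pos_part.
Local Notation neg := neg_part.
Local Notation cls p := (@sym_class B p : sym_hypermagma B).

Lemma sym_class_surj (x : sym_hypermagma B) : exists p, x = cls p.
Proof. by exists (repr x); rewrite /sym_class reprK. Qed.

(** One part of each signed element is [0], so the cross equation reduces to [a = b] or [a + b = 0],
    the two clauses of [sym_rel]. *)
Lemma sym_class_eqE p q :
  (cls p = cls q) = (pos p + neg q = neg p + pos q).
Proof.
have -> : (cls p = cls q) = sym_rel p q :> Prop.
  by apply/propext; split=> /sym_classP.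
rewrite /sym_rel /pos_part /neg_part.
case: p q => a [] [b []] /=; rewrite ?addr0 ?add0r //; apply/propext;
  by split=> [/eqP|->].
Qed.

Lemma sym_hadd_memE p q r :
  hadd (cls p) (cls q) (cls r) =
  (pos p + pos q + neg r = neg p + neg q + pos r).
Proof.
rewrite /hadd /= sym_haddE.
have mixed a b : ([set sym_class (z, true) | z in [set z | z + b = a]] `|`
    [set sym_class (z, false) | z in [set z | z + a = b]]) (cls r) =
    (a + neg r = b + pos r).
  apply/propext; split.
    case=> -[z /= <-]; rewrite sym_class_eqE /pos_part /neg_part /= add0r => e.
      by rewrite addrAC e addrC.
    by rewrite [RHS]addrAC -e addrC.
  by case: r => c [] /=; rewrite /pos_part /neg_part /= addr0 => e;
    [left | right]; exists c; rewrite //= addrC e.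
have single c s : [set sym_class (c, s)] (cls r) =
    (pos (c, s) + neg r = neg (c, s) + pos r).
  by rewrite -sym_class_eqE; apply/propext; split=> /esym.
by case: p q => a [] [b []]; rewrite ?[LHS]single ?[LHS]mixed
  /pos_part /neg_part /= ?add0r ?addr0.
Qed.

Lemma sym_haddC (x y : sym_hypermagma B) : hadd x y = hadd y x.
Proof.
have [[p ->] [q ->]] := (sym_class_surj x, sym_class_surj y).
apply/funext => w; have [r ->] := sym_class_surj w.
by rewrite !sym_hadd_memE (addrC (pos p)) (addrC (neg p)).
Qed.

Lemma sym_hadd0 (x : sym_hypermagma B) : hadd hzero x = [set x].
Proof.
have [p ->] := sym_class_surj x.
apply/funext => w; have [r ->] := sym_class_surj w.
rewrite [LHS]sym_hadd_memE !add0r -sym_class_eqE.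
by apply/propext; split=> /esym.
Qed.

(** The membership equation for zero is [pos p + pos q = neg p + neg q], and flipping the sign of
    [p] exchanges [pos p] and [neg p]. Existence and uniqueness of opposites both follow. *)
Lemma sym_hadd_opp p q :
  hadd (cls p) (cls q) hzero = (cls q = cls (p.1, ~~ p.2)).
Proof.
rewrite [LHS]sym_hadd_memE sym_class_eqE /pos_part /neg_part /= !addr0.
by case: p q => a [] [b []] /=; rewrite ?addr0 ?add0r // addrC.
Qed.

(* At most one of [pos t], [neg t] is nonzero for the middle term t, so the two
   equations defining membership combine without cancellation in B. *)
Lemma sym_hadd_set_memE p q r w : sym_property B ->
  hadd_set (hadd (cls p) (cls q)) [set cls r] (cls w) =
  (pos p + pos q + (pos r + neg w) = neg p + neg q + (neg r + pos w)).
Proof.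
move=> BP; apply/propext; split.
  case=> x xpq [_ -> ]; have [t xE] := sym_class_surj x.
  move: xpq; rewrite {}xE !sym_hadd_memE.
  case: t => c []; rewrite [pos (c, _)]/pos_part [neg (c, _)]/neg_part /=
    ?addr0 ?add0r => e1 e2.
    by rewrite e1 -addrA [c + _]addrA e2.
  by rewrite e2 -e1 !addrA.
(* The middle term is read off the cut: [pos p + pos q + z = neg p + neg q] puts [(z, false)] in the
   sum of [p] and [q]; the other alternative puts [(z, true)] there. *)
move=> /BP[z [[e1 e2]|[e1 e2]]].
  exists (cls (z, false)); first by rewrite sym_hadd_memE [RHS]addr0.
  by exists (cls r); rewrite // sym_hadd_memE /= -addrA [LHS]add0r -e2 addrA.
exists (cls (z, true)); first by rewrite sym_hadd_memE [LHS]addr0.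
by exists (cls r); rewrite // sym_hadd_memE -addrA -[RHS]addrA [RHS]add0r.
Qed.

Lemma sym_hypergroup : sym_property B -> is_hypergroup (sym_hypermagma B).
Proof.
move=> BP; split.
- move=> x y; have [[p ->] [q ->]] := (sym_class_surj x, sym_class_surj y).
  (* Cutting the trivial equation [m + n = n + m] shows that one of the total positive and negative
     parts is the other plus some [z]; signed accordingly, [z] lies in the sum. *)
  have [z [[e _]|[e _]]] :=
    BP _ _ _ _ (addrC (pos p + pos q) (neg p + neg q)).
    by exists (cls (z, false)); rewrite sym_hadd_memE [RHS]addr0.
  by exists (cls (z, true)); rewrite sym_hadd_memE [LHS]addr0.
- exact: sym_haddC.
(* The right bracketing becomes [(y + z) + x], so one membership formula serves both sides. *)
- move=> x y z; rewrite [RHS](hadd_setC _ _ sym_haddC).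
  have [[p ->] [q ->]] := (sym_class_surj x, sym_class_surj y).
  have [r ->] := sym_class_surj z.
  apply/funext => w; have [{}w ->] := sym_class_surj w.
  have rot a b c d : b + c + (a + d) = a + b + (c + d) :> B.
    by rewrite addrCA !addrA.
  by rewrite !sym_hadd_set_memE // (rot (pos p)) (rot (neg p)).
- by move=> x; rewrite [hadd x _]sym_haddC sym_hadd0.
- move=> x; have [p ->] := sym_class_surj x.
  exists (cls (p.1, ~~ p.2)); split; first by rewrite sym_hadd_opp.
  by move=> y; have [q ->] := sym_class_surj y; rewrite sym_hadd_opp.
- move=> x y z y'.
  have [[p ->] [q ->]] := (sym_class_surj x, sym_class_surj y).
  have [[r ->] [q' ->]] := (sym_class_surj z, sym_class_surj y').
  rewrite sym_hadd_opp => ->; rewrite !sym_hadd_memE => e.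
  have -> : pos (q.1, ~~ q.2) = neg q by case: (q) => ? [].
  have -> : neg (q.1, ~~ q.2) = pos q by case: (q) => ? [].
  by rewrite -addrA addrC -e addrC addrA.
Qed.

(* From x + y = u + v, reversibility puts y in (u + v) - x = v + (u - x); the
   element of u - x obtained in this way is z or -z. *)
Lemma hypergroup_sym_property :
  is_hypergroup (sym_hypermagma B) -> sym_property B.
Proof.
move=> hg x y u v e.
have yE : hadd_set (hadd (cls (v, true)) (cls (u, true)))
    [set cls (x, false)] (cls (y, true)).
  exists (cls (u + v, true)).
    by rewrite sym_hadd_memE /pos_part /neg_part /= !addr0 add0r addrC.
  exists (cls (x, false)) => //.
  by rewrite sym_hadd_memE /pos_part /neg_part /= !addr0 add0r e.
move: yE; rewrite (hg_assoc hg) => -[_ -> [t]].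
have [{}t ->] := sym_class_surj t.
rewrite !sym_hadd_memE; case: t => z [];
  rewrite /pos_part /neg_part /= ?addr0 ?add0r => e1 e2; exists z; [left|right].
  by rewrite e1 [z + v]addrC e2.
by rewrite e1 e2.
Qed.

End Symmetrization.

Section Hypergroup.
Variables (K : hypermagma) (hg : is_hypergroup K).
Implicit Types x y z : K.

Definition hopp x : K := projT1 (cid (hg_opp hg x)).

Lemma haddN x : hadd x (hopp x) hzero.
Proof. by rewrite /hopp; case: cid => y []. Qed.

Lemma hopp_uniq x y : hadd x y hzero -> y = hopp x.
Proof.
move=> xy; have [z [_ zP]] := hg_opp hg x.
by rewrite -(zP _ xy) -(zP _ (haddN x)).
Qed.

Lemma hoppK x : hopp (hopp x) = x.
Proof. by apply/esym/hopp_uniq; rewrite (hg_comm hg); apply: haddN. Qed.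

Lemma hadd_rev x y z : hadd y z x -> hadd x (hopp y) z.
Proof. exact: hg_rev (haddN y). Qed.

(** Three reversals: [z] lies in [x - y], then [-y] in [z - x], then [-x] in [-y - z]. *)
Lemma hadd_opp x y z : hadd y z x -> hadd (hopp y) (hopp z) (hopp x).
Proof. by move=> /hadd_rev /hadd_rev /hadd_rev. Qed.

End Hypergroup.

Lemma hmorphism_opp (H K : hypermagma) (hgK : is_hypergroup K) (h : H -> K) x y :
  is_hmorphism h -> hadd x y hzero -> h y = hopp hgK (h x).
Proof.
move=> [h0 hD] xy; apply: hopp_uniq; rewrite -h0.
by apply: hD; exists hzero.
Qed.

Section Extension.
Variables (B : nmodType) (K : hypermagma) (hg : is_hypergroup K).
Variables (g : B -> K) (g_add : is_additive g).

Definition sym_ext_repr (p : B * bool) : K :=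
  if p.2 then g p.1 else hopp hg (g p.1).

Definition sym_ext (x : sym_hypermagma B) : K := sym_ext_repr (repr x).

Lemma sym_ext_repr_eq p q : sym_rel p q -> sym_ext_repr p = sym_ext_repr q.
Proof.
case: p q => a s [b t]; rewrite /sym_rel /sym_ext_repr /=.
(* Additivity puts [g 0], which is the zero of [K], in [g c + g d]. *)
have gopp c d : c + d = 0 -> g d = hopp hg (g c).
  by move=> cd; apply: hopp_uniq; rewrite -g_add.1 -cd; apply: g_add.2.
by case: s t => [] [] /= /eqP => [->|/gopp->|/gopp->|->]; rewrite ?hoppK.
Qed.

Lemma sym_ext_class p : sym_ext (sym_class p) = sym_ext_repr p.
Proof. by apply/sym_ext_repr_eq/sym_classP; rewrite /sym_class reprK. Qed.

Lemma sym_ext_morphism : is_hmorphism sym_ext.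
Proof.
split; first by rewrite sym_ext_class; apply: g_add.1.
have gD := g_add.2.
have mixed a b w : (([set sym_class (z, true) | z in [set z | z + b = a]] `|`
    [set sym_class (z, false) | z in [set z | z + a = b]])
    : set (sym_type B)) w ->
    hadd (g a) (hopp hg (g b)) (sym_ext w).
  (* If [z + b = a], reversal turns [g a] in [g b + g z] into [g z] in [g a - g b]. If [z + a = b],
     it gives [g z] in [g b - g a], and opposites are taken throughout. *)
  case=> -[z /= zE <-]; rewrite sym_ext_class /sym_ext_repr /=.
    by apply: hadd_rev; rewrite (hg_comm hg) -zE.
  rewrite -[g a](hoppK hg); apply: hadd_opp.
  rewrite (hg_comm hg); apply: hadd_rev.
  by rewrite (hg_comm hg) -zE.
move=> x y _ [w + <-].
have [[p ->] [q ->]] := (sym_class_surj x, sym_class_surj y).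
rewrite /hadd /= -/(@hadd K) sym_haddE !sym_ext_class.
case: p q => a [] [b []] /=; rewrite /sym_ext_repr /=.
- by move=> ->; rewrite sym_ext_class; apply: gD.
- exact: mixed.
- by rewrite (hg_comm hg); apply: mixed.
- by move=> ->; rewrite sym_ext_class; apply/hadd_opp/gD.
Qed.

(** The classes of [(a, true)] and [(a, false)] are opposite and morphisms preserve opposites, so
    the values on the image of [B] force all others. *)
Lemma sym_ext_uniq (h : sym_hypermagma B -> K) :
  is_hmorphism h -> g = (fun b => h (sym_inj b)) -> sym_ext = h.
Proof.
move=> hM gE; apply/funext => x; have [[a s] ->] := sym_class_surj x.
rewrite sym_ext_class /sym_ext_repr gE; case: s => //=.
by apply/esym/(hmorphism_opp hg hM); rewrite sym_hadd_opp.
Qed.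

End Extension.

Theorem theorem5p1 (B : nmodType) :
  (is_hypergroup (sym_hypermagma B) <-> sym_property B) /\
  (sym_property B ->
     is_hypergroup (sym_hypermagma B) /\
     is_additive (@sym_inj B) /\
     (forall (K : hypermagma) (g : B -> K),
        is_hypergroup K -> is_additive g ->
        exists! h : sym_hypermagma B -> K,
          is_hmorphism h /\ g = (fun b : B => h (sym_inj b)))).
Proof.
split; first by split; [exact: hypergroup_sym_property | exact: sym_hypergroup].
move=> BP; split; first exact: sym_hypergroup.
split; first by split=> // a b; rewrite /hadd /= sym_haddE.
move=> K g hg g_add; exists (sym_ext hg g); split.
  split; first exact: sym_ext_morphism.
  by apply/funext => b; rewrite sym_ext_class.
by move=> h [hM gE]; apply: sym_ext_uniq.
Qed.
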